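(* Let $X$ be a Tychonoff topological space which is hereditarily Lindelöf and is an $F_{\sigma\delta}$ space. Then $X$ is absolutely $F_{\sigma\delta}$.
   Context: A compactification of a Tychonoff space $X$ is a pair $(cX,\varphi)$ where $cX$ is a compact (Hausdorff) space and $\varphi$ is a homeomorphic embedding of $X$ onto a dense subspace of $cX$; we identify $X$ with $\varphi(X)$. $X$ is called an $F_{\sigma\delta}$ space if there exists a compactification $cX$ of $X$ such that $X$ is an $F_{\sigma\delta}$ subset of $cX$ (a countable intersection of countable unions of closed subsets of $cX$). $X$ is called absolutely $F_{\sigma\delta}$ if $X$ is an $F_{\sigma\delta}$ subset of $cX$ for every compactification $cX$ of $X$. *)

(* Defs.v *)
From HB Require Import structures.
From mathcomp Require Import all_boot all_order all_algebra.
From mathcomp Require Import all_classical all_reals topology.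
From mathcomp Require Import Rstruct Rstruct_topology.
From Stdlib Require Import Rdefinitions.

Set Implicit Arguments.
Unset Strict Implicit.
Unset Printing Implicit Defensive.

Local Open Scope classical_set_scope.

Definition completely_regular (T : topologicalType) : Prop :=
  forall (C : set T) (x : T), closed C -> ~ C x ->
    exists f : T -> Rdefinitions.R,
      continuous f /\ f x = 0%R /\ (forall y, C y -> f y = 1%R).

Definition tychonoff_space (T : topologicalType) : Prop :=
  accessible_space T /\ completely_regular T.

Definition lindelof_set (T : topologicalType) (A : set T) : Prop :=
  forall (I : Type) (U : I -> set T), (forall i, open (U i)) ->
    A `<=` \bigcup_(i in [set: I]) U i ->
    exists J : set I, countable J /\ A `<=` \bigcup_(i in J) U i.

Definition hereditarily_lindelof (T : topologicalType) : Prop :=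
  forall A : set T, lindelof_set A.

Definition Fsigmadelta (T : topologicalType) (A : set T) : Prop :=
  exists F : nat -> nat -> set T, (forall n m, closed (F n m)) /\
    A = \bigcap_(n in [set: nat]) \bigcup_(m in [set: nat]) F n m.

Definition is_compactification (X cX : topologicalType) (f : X -> cX) : Prop :=
  [/\ compact [set: cX], hausdorff_space cX, dense (range f)
    & [/\ injective f, continuous f
         & (forall U : set X, open U ->
              exists V : set cX, open V /\ f @` U = V `&` range f)]].

Definition Fsigmadelta_space (X : topologicalType) : Prop :=
  exists (cX : topologicalType) (f : X -> cX),
    is_compactification f /\ Fsigmadelta (range f).

Definition absolutely_Fsigmadelta (X : topologicalType) : Prop :=
  forall (cX : topologicalType) (f : X -> cX),
    is_compactification f -> Fsigmadelta (range f).

(* Main.v *)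
(** Let [X] be F_σδ in [cX], witnessed by closed sets [F n m], and let [g]
    embed [X] in another compactification [dX].  Put [C n m := F n m ∩ X].
    A point [y] of [dX] that lies in the closures of the sets
    [C 0 (m 0) ∩ ... ∩ C n (m n)] for all [n], for one fixed branch [m],
    belongs to [X] by compactness of [cX].  The obstacle is that
    [y ∈ ⋂_n ⋃_m cl (C n m)] only provides [y ∈ cl (C n (m n))] for every [n].
    As [X] is hereditarily Lindelöf, the open set [X \ C n m] is contained in
    an F_σ subset [W n m] of [dX] that misses [cl (C n m)].  For every finite
    sequence [s] the F_σ set [cl (⋂_k C k (s k)) ∪ ⋃_k W k (s k)] contains
    [X], and for a point of it, lying in all the [cl (C k (s k))] implies lying
    in the closure of their intersection.  Hence intersecting these countably
    many F_σ sets with [⋂_n ⋃_m cl (C n m)] gives exactly [X]. *)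
Require Import Defs.
From mathcomp Require Import all_boot.
From mathcomp Require Import all_classical all_reals topology.

Set Implicit Arguments.
Unset Strict Implicit.
Unset Printing Implicit Defensive.

Local Open Scope classical_set_scope.

Lemma Fsigmadelta_countable (T : topologicalType) (I J : countType)
    (F : I -> J -> set T) : (forall i j, closed (F i j)) ->
  Fsigmadelta (\bigcap_(i in [set: I]) \bigcup_(j in [set: J]) F i j).
Proof.
move=> clF.
(* Numbers that code nothing get the neutral values: [setT] for the intersection, [set0] for the
   union. *)
exists (fun n m => if unpickle n is Some i then
  (if unpickle m is Some j then F i j else set0) else setT); split.
  move=> n m; case: unpickle => [i|]; last exact: closedT.
  by case: unpickle => [j|]; [exact: clF|exact: closed0].
apply/seteqP; split=> y /= Fy.
- move=> n _; case: (unpickle n) => [i|]; last by exists 0.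
  by have [j _ Fijy] := Fy i Logic.I; exists (pickle j) => //; rewrite pickleK.
- move=> i _; have [m _] := Fy (pickle i) Logic.I; rewrite pickleK.
  by case: (unpickle m) => [j|//]; exists j.
Qed.

Lemma bigcup_countable_closed (T : topologicalType) (I : Type) (J : set I)
    (F : I -> set T) : countable J -> (forall i, closed (F i)) ->
  exists K : nat -> set T, (forall j, closed (K j)) /\
    \bigcup_(i in J) F i = \bigcup_(j in [set: nat]) K j.
Proof.
move=> /countable_injP[e e_inj] clF.
exists (fun j => if pselect (exists i, J i /\ e i = j) is left p
                 then F (sval (cid p)) else set0); split.
  by move=> j; case: pselect => [p|_]; [exact: clF|exact: closed0].
apply/seteqP; split=> y [].
- move=> i Ji Fiy; exists (e i) => //.
  case: pselect => [p|[]]; last by exists i.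
  case: cid => i' /= [Ji' ei'].
  by have -> : i' = i by apply: e_inj => //; exact/mem_set.
- move=> j _; case: pselect => [p|//].
  by case: cid => i /= [Ji _] Fiy; exists i.
Qed.

Lemma Fsigma_separation (X Y : topologicalType) (g : X -> Y) (C : set X) :
  hereditarily_lindelof X -> is_compactification g -> closed C ->
  exists K : nat -> set Y, [/\ forall j, closed (K j),
    forall x, ~ C x -> exists j, K j (g x)
    & forall j y, K j y -> ~ closure (g @` C) y].
Proof.
move=> hL [cptY hdY _ [g_inj g_cont g_emb]] clC.
have [V [oV gV]] := g_emb _ (closed_openC clC).
pose I := {O : set Y | open O /\ closure O `<=` V}.
have oI (O : I) : open (g @^-1` sval O).
  by apply: open_comp (svalP O).1 => x _; exact: g_cont.
have [x nCx|J [Jc JC]] := hL (~` C) I _ oI.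
  have Vgx : V (g x).
    have : (g @` (~` C)) (g x) by exists x.
    by rewrite gV => -[].
  have [D /nbhs_interior nD cDV] :=
    @compact_regular Y (g x) _ hdY cptY filterT V (open_nbhs_nbhs (conj oV Vgx)).
  have p : open D^° /\ closure D^° `<=` V.
    split; first exact: open_interior.
    by apply: subset_trans cDV; apply: closure_subset; exact: interior_subset.
  by exists (exist _ D^° p) => //=; exact: nbhs_singleton.
have [K [clK KE]] := bigcup_countable_closed Jc
  (fun O : I => @closed_closure _ (sval O)).
exists K; split=> //.
- move=> x /JC[O JO Ox].
  have : (\bigcup_(O in J) closure (sval O)) (g x).
    by exists O => //; exact: subset_closure.
  by rewrite KE => -[j _]; exists j.
- move=> j y Kjy cly.
  have : (\bigcup_(O in J) closure (sval O)) y by rewrite KE; exists j.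
  move=> [[O [oO OV]] _ /= /OV Vy].
  have [_ [[x Cx <-] Vgx]] := cly _ (open_nbhs_nbhs (conj oV Vy)).
  have : (V `&` range g) (g x) by split=> //; exists x.
  by rewrite -gV => -[x' nCx' /g_inj xx']; apply: nCx'; rewrite xx'.
Qed.

(** The traces on [X] of neighbourhoods of [y], cut down by finitely many [F k], are nonempty and
    generate a filter on [cX]. A cluster point lies in every [F n], so it is some [f x], and
    [g x = y] since [dX] is Hausdorff. *)
Lemma branch_closure_in_range (X cX dX : topologicalType) (f : X -> cX)
    (g : X -> dX) (F : nat -> set cX) (y : dX) :
  is_compactification f -> is_compactification g ->
  (forall n, closed (F n)) -> \bigcap_(n in [set: nat]) F n `<=` range f ->
  (forall n, closure (g @` [set x | forall k, k < n -> F k (f x)]) y) ->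
  range g y.
Proof.
move=> [cptX _ _ [f_inj f_cont f_emb]] [_ hdY _ [_ g_cont _]] clF Ff yF.
pose B (i : set dX * nat) : set cX :=
  f @` [set x | i.1 (g x) /\ forall k, k < i.2 -> F k (f x)].
pose G := filter_from [set i : set dX * nat | nbhs y i.1] B.
have GP : ProperFilter G.
  apply: filter_from_proper.
    apply: filter_from_filter.
      by exists (setT, 0); exact: filterT.
    move=> [U n] [U' n'] /= yU yU'; exists (U `&` U', maxn n n') => /=.
      exact: filterI.
    move=> _ [x /= [[Ux U'x] Fx] <-]; split; exists x => //; split=> // k kn;
      by apply: Fx; rewrite leq_max kn ?orbT.
  move=> [U n] /= yU; have [_ [[x Fx <-] Ux]] := yF n _ yU.
  by exists (f x), x.
have [z [_ Gz]] := cptX G GP filterT.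
have [x _ fxz] : range f z.
  apply: Ff => n _; apply: clF => U zU.
  (* The bound in [B] is strict, so [n.+1] is what imposes [F n]. *)
  apply: Gz zU; exists (setT, n.+1); first exact: filterT.
  by move=> _ [x /= [_ Fx] <-]; exact: Fx.
exists x => //; apply: contrapT => /eqP; move: hdY; rewrite open_hausdorff.
move=> hdY /hdY[[A B'] /= [/set_mem Agx /set_mem By] [oA oB /eqP AB0]].
(* The neighbourhood [A] of [g x] is carried through [X] to a neighbourhood [V] of [z] in [cX],
   where clustering applies. *)
have [V [oV fV]] := f_emb (g @^-1` A)
  (open_comp (fun x _ => g_cont x) oA).
have zV : nbhs z V.
  apply: open_nbhs_nbhs; split=> //; rewrite -fxz.
  have : (f @` (g @^-1` A)) (f x) by exists x.
  by rewrite fV => -[].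
have GB : G (B (B', 0)) by exists (B', 0) => //; exact: open_nbhs_nbhs.
have [_ [[x' [Bx' _] <-] Vx']] := Gz _ _ GB zV.
have : (V `&` range f) (f x') by split=> //; exists x'.
rewrite -fV => -[x'' Ax'' /f_inj xx]; rewrite xx in Ax''.
by have : (A `&` B') (g x') by []; rewrite AB0.
Qed.

Theorem theorem4p1 (X : topologicalType) :
  tychonoff_space X -> hereditarily_lindelof X -> Fsigmadelta_space X ->
  absolutely_Fsigmadelta X.
Proof.
move=> _ hL [cX [f [cf [F [clF fF]]]]] dX g cg.
have f_cont : continuous f by have [_ _ _ []] := cf.
pose C n m := f @^-1` F n m.
have clC n m : closed (C n m).
  by apply: closed_comp => // x _; exact: f_cont.
have [W WP] := choice (fun p : nat * nat =>
  Fsigma_separation hL cg (clC p.1 p.2)).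
pose Cs (s : seq nat) := [set x | forall k, k < size s -> C k (nth 0 s k) x].
(* Rows [inl s] are the corrections for finite sequences, rows [inr n] the unions over [m] of the
   closures of [C n m]; the [j] of an [inr] row is a dummy. *)
pose H (i : seq nat + nat) (j : option (nat * nat)) : set dX :=
  match i, j with
  | inl s, None => closure (g @` Cs s)
  | inl s, Some (k, j) => if k < size s then W (k, nth 0 s k) j else set0
  | inr n, Some (m, _) => closure (g @` C n m)
  | inr _, None => set0
  end.
suff -> : range g = \bigcap_(i in [set: seq nat + nat])
    \bigcup_(j in [set: option (nat * nat)]) H i j.
  apply: Fsigmadelta_countable => -[s|n] [[k j]|] /=; try exact: closed_closure.
    by case: ifP => _; [have [] := WP (k, nth 0 s k)|exact: closed0].
  exact: closed0.
apply/seteqP; split=> [_ [x _ <-] [s|n] _|y Hy].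
- have [Csx|/existsNP[k /not_implyP[ks nCx]]] := pselect (Cs s x).
    by exists None => //; apply: subset_closure; exists x.
  have [_ /(_ _ nCx)[j Wj] _] := WP (k, nth 0 s k).
  by exists (Some (k, j)) => //=; rewrite ks.
- have : range f (f x) by exists x.
  rewrite fF => /(_ n Logic.I)[m _ Fx].
  by exists (Some (m, 0)) => //; apply: subset_closure; exists x.
have /choice[m ym] n : exists m, closure (g @` C n m) y.
  by have [[[m j]|] _ //] := Hy (inr n) Logic.I; exists m.
apply: (branch_closure_in_range (F := fun n => F n (m n)) cf cg) => //.
- by move=> z Fz; rewrite fF => n _; exists (m n) => //; exact: Fz.
(* In the row of the initial segment of [m], [ym] excludes every [W] piece, which leaves the closure
   of the finite intersection. *)
- move=> n; have [[[k j]|] _ /=] := Hy (inl (mkseq m n)) Logic.I.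
    case: ifP => //; rewrite size_mkseq => kn; rewrite nth_mkseq// => Wy.
    by have [_ _ /(_ _ _ Wy)] := WP (k, m k).
  apply: closure_subset; apply: image_subset => x Csx k kn.
  by have := Csx k; rewrite size_mkseq nth_mkseq//; exact.
Qed.
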